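(* Let $r\geq5$ be odd and let $\varnothing\neq I=\{i_1<\cdots<i_k\}\subseteq\{1,\ldots,r-1\}$. Then $$\nu_0(c_I)=A_I\sqcup B_I$$ (disjoint union). Moreover, for $a\in I$ and $a<b<n_I(a)$, $$c_I^{-1}(e_b-e_{n_I(a)})=e_a-e_b,$$ and, for $i_1<q\leq r$, if $t\in\{1,\ldots,r-1\}$ is the unique index with $p_I(t)=q$, then $$c_I^{-1}(e_{i_1}-e_q)=e_t+e_r.$$
   Context: Let $e_1,\ldots,e_r$ be the standard orthonormal basis of $\mathbb R^r$. $W(D_r)$ is the group of linear maps $u$ with $u(e_j)=\varepsilon_j e_{\pi(j)}$, $\pi\in S_r$, $\varepsilon_j\in\{\pm1\}$, with an even number of negative signs. Positive roots: $\Pi_+=\{e_i-e_j,\ e_i+e_j:1\leq i<j\leq r\}$. For $u\in W(D_r)$, $\nu_0(u)=u(\Pi_+)\cap\Pi_+$. For $I$ as in the claim, $p_I\in S_r$ is given by $p_I(i_a)=i_{a+1}$ ($1\leq a<k$), $p_I(i_k)=r$, $p_I(r)=i_1$, $p_I(j)=j$ for $j\notin I\cup\{r\}$. The element $c_I\in W(D_r)$ is given by $c_I(e_j)=-e_{p_I(j)}$ ($1\leq j\leq r-1$), $c_I(e_r)=e_{i_1}$. For $a\in I$, $n_I(a)$ denotes the next element of $I\cup\{r\}$ after $a$, i.e. $n_I(i_a)=i_{a+1}$ for $1\leq a<k$ and $n_I(i_k)=r$. Finally $A_I=\{e_b-e_{n_I(a)}:a\in I,\ a<b<n_I(a)\}$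 and $B_I=\{e_{i_1}-e_q:i_1<q\leq r\}$. *)

(* Defs.v *)
From mathcomp Require Import all_boot all_order all_algebra all_fingroup.
From mathcomp Require Import boolp classical_sets reals.

Set Implicit Arguments.
Unset Strict Implicit.
Unset Printing Implicit Defensive.

Import GRing.Theory.
Local Open Scope ring_scope.

(* The rank is r = n.+1; the index j in {1, ..., r} is the ordinal of value   *)
(* j - 1 in 'I_n.+1, so that the index r is ord_max.                          *)

Section Indices.
Variable n : nat.
Implicit Types (I : {set 'I_n.+1}) (a j : 'I_n.+1).

(* enum lists a set of ordinals increasingly: enum I is [:: i_1; ...; i_k].   *)
Definition i1 I : 'I_n.+1 := head ord_max (enum I).

(* The cycle (i_1 ... i_k r); next fixes the indices outside of the cycle.    *)
Definition pI I : {perm 'I_n.+1} :=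
  perm (can_inj (prev_next (enum_uniq (ord_max |: I)))).

Definition nI I a : 'I_n.+1 :=
  [arg min_(b < ord_max | (b \in ord_max |: I) && (a < b)%N) (b : nat)].

Lemma enum_ord_sorted (A : {set 'I_n.+1}) : sorted ltn (map val (enum A)).
Proof.
rewrite sorted_map /enum_mem -enumT.
apply: sorted_filter; first by move=> x y z /=; apply: ltn_trans.
by rewrite -(@sorted_map _ _ val ltn) val_enum_ord iota_ltn_sorted.
Qed.

Lemma enum_setU1_max I : ord_max \notin I ->
  enum (ord_max |: I) = rcons (enum I) ord_max.
Proof.
move=> rI; apply: (inj_map val_inj); apply: (irr_sorted_eq ltn_trans ltnn).
- exact: enum_ord_sorted.
- rewrite map_rcons -cats1 sorted_pairwise ?pairwise_cat; last exact: ltn_trans.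
  rewrite -sorted_pairwise ?enum_ord_sorted /=; last exact: ltn_trans.
  rewrite !andbT; apply/allrelP => _ _ /mapP[x xI ->] /[1!inE] /eqP ->.
  move: xI; rewrite mem_enum => xI /=; rewrite ltn_neqAle -ltnS ltn_ord andbT.
  by apply: contraNneq rI => xn; rewrite (_ : ord_max = x) //; apply: val_inj.
move=> x; apply/mapP/mapP => -[y yI ->]; exists y => //.
  by move: yI; rewrite mem_rcons !inE !mem_enum !inE.
by move: yI; rewrite mem_rcons !inE !mem_enum !inE.
Qed.

(* With default value r, nth gives i_(k+1) the value r, and k is #|I|.        *)
Lemma pI_nth I (m : nat) : ord_max \notin I -> (m < #|I|)%N ->
  pI I (nth ord_max (enum I) m) = nth ord_max (enum I) m.+1.
Proof.
move=> rI mk; have sz : size (enum I) = #|I| by rewrite cardE.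
have := enum_uniq (ord_max |: I); rewrite permE enum_setU1_max // => uI.
have -> : nth ord_max (enum I) m = nth ord_max (rcons (enum I) ord_max) m.
  by rewrite nth_rcons sz mk.
have ms : (m < size (rcons (enum I) ord_max))%N by rewrite size_rcons sz ltnW.
rewrite next_nth mem_nth // index_uniq //.
case: (enum I) sz => [|x s] /= sz; first by rewrite -sz in mk.
rewrite nth_rcons; case: ltnP => h; first exact: set_nth_default.
rewrite nth_default //; move: mk; rewrite -sz ltnS => mk.
by rewrite eqn_leq mk h.
Qed.

Lemma pI_last I : ord_max \notin I -> pI I ord_max = i1 I.
Proof.
move=> rI; rewrite permE /i1; have := enum_uniq (ord_max |: I).
rewrite enum_setU1_max // rcons_uniq => /andP[rE _].
rewrite next_nth mem_rcons inE eqxx /=.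
case E: (enum I) rE => [|x s] /=; first by rewrite eqxx.
rewrite inE negb_or eq_sym => /andP[/negbTE -> rs].
rewrite -cats1 index_cat (negbTE rs) /= eqxx addn0 nth_default //.
by rewrite size_cat addn1.
Qed.

Lemma pI_out I j : j \notin I -> j != ord_max -> pI I j = j.
Proof.
by move=> jI jr; rewrite permE next_nth mem_enum !inE (negbTE jr) (negbTE jI).
Qed.

Lemma nI_nth I (m : nat) : ord_max \notin I -> (m < #|I|)%N ->
  nI I (nth ord_max (enum I) m) = nth ord_max (enum I) m.+1.
Proof.
move=> rI mk; have sz : size (enum I) = #|I| by rewrite cardE.
pose s := enum (ord_max |: I).
have sE : s = rcons (enum I) ord_max by apply: enum_setU1_max.
have ssz : size s = #|I|.+1 by rewrite sE size_rcons sz.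
have nthE k : nth ord_max (enum I) k = nth ord_max s k.
  rewrite sE nth_rcons; case: ltnP => // h; rewrite nth_default //.
  by case: eqP.
have lt_s (j k : nat) : (k <= #|I|)%N -> (j < k)%N ->
    (nth ord_max s j < nth ord_max s k)%N.
  move=> kI jk; have := enum_ord_sorted (ord_max |: I); rewrite -/s.
  move=> /(sorted_ltn_nth ltn_trans 0%N)/(_ j k).
  rewrite !inE !size_map ssz !ltnS => /(_ (leq_trans (ltnW jk) kI) kI jk).
  by rewrite !(nth_map ord_max) ?ssz ?ltnS // (leq_trans (ltnW jk) kI).
rewrite !nthE /nI; case: arg_minnP.
  have := lt_s _ _ (leqnn _) mk; rewrite -(nthE #|I|) [nth _ _ #|I|]nth_default ?sz // => h.
  by rewrite !inE eqxx.
move=> x /andP[xI mx] /(_ (nth ord_max s m.+1)).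
rewrite -mem_enum mem_nth ?ssz ?ltnS // lt_s //= => /(_ isT) xle.
apply/val_inj/eqP; rewrite /= eqn_leq xle /=.
have xs : x \in s by rewrite mem_enum.
rewrite -(nth_index ord_max xs) in mx *.
have ik : (index x s <= #|I|)%N by rewrite -ltnS -ssz index_mem.
case: (ltngtP m.+1 (index x s)) => [h|h|-> //]; first exact/ltnW/lt_s.
move: h; rewrite ltnS leq_eqVlt => /orP[/eqP h|h].
  by rewrite h ltnn in mx.
by have := lt_s _ _ (ltnW mk) h; rewrite ltnNge ltnW.
Qed.

End Indices.

Section Roots.
Variables (R : realType) (n : nat).
Local Notation V := 'rV[R]_n.+1.
Local Open Scope classical_set_scope.
Implicit Types (I : {set 'I_n.+1}) (u : 'End(V)).

Definition e (j : 'I_n.+1) : V := delta_mx ord0 j.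

Definition WD : set 'End(V) := [set u | exists pi : {perm 'I_n.+1},
  exists eps : 'I_n.+1 -> bool,
    (forall j, u (e j) = (-1) ^+ eps j *: e (pi j)) /\
    ~~ odd #|[set j | eps j]%SET|].

Definition posroots : set V := [set x | exists i j : 'I_n.+1,
  (i < j)%N /\ (x = e i - e j \/ x = e i + e j)].

Definition nu0 u : set V := (u @` posroots) `&` posroots.

Definition cI I : 'End(V) :=
  linfun (mulmxr (\matrix_(j < n.+1)
    (if j == ord_max then e (i1 I) else - e (pI I j)))).

Definition AI I : set V := [set x | exists a b : 'I_n.+1,
  [/\ a \in I, (a < b)%N, (b < nI I a)%N & x = e b - e (nI I a)]].

Definition BI I : set V := [set x | exists q : 'I_n.+1,
  (i1 I < q)%N /\ x = e (i1 I) - e q].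

Lemma cI_e I j : cI I (e j) =
  if j == ord_max then e (i1 I) else - e (pI I j).
Proof. by rewrite lfunE /= /e -rowE rowK. Qed.

Lemma cI_WD I : odd n.+1 -> ord_max \notin I -> WD (cI I).
Proof.
move=> r_odd rI; exists (pI I), (fun j => j != ord_max); split=> [j|].
  rewrite cI_e; case: eqP => [->|_] /=; last by rewrite expr1 scaleN1r.
  by rewrite expr0 scale1r pI_last.
rewrite (_ : [set j | j != ord_max]%SET = [set~ ord_max]%SET).
  by rewrite cardsC1 card_ord.
by apply/setP => j; rewrite !inE.
Qed.

(* Hence u^-1%VF is the two-sided inverse of every u in W(D_r).               *)
Lemma WD_lker0 u : WD u -> lker u == 0%VS.
Proof.
move=> [pi [eps [uE _]]]; apply/lker0P => x y.
apply: contra_eq => /eqP xy; apply/eqP => uxy; apply: xy.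
suff h (z : V) i : u z ord0 (pi i) = (-1) ^+ eps i * z ord0 i.
  apply/rowP => i; have := h x i; rewrite uxy h.
  by move/(mulfI (negbT (signr_eq0 _ _))).
rewrite {1}(row_sum_delta z) linear_sum summxE (bigD1 i) //= linearZ /=.
rewrite -/(e i) uE !mxE !eqxx mulr1 mulrC big1 ?addr0 // => j ji.
rewrite linearZ /= -/(e j) uE !mxE /= (inj_eq perm_inj) eq_sym (negbTE ji).
by rewrite !mulr0.
Qed.

End Roots.

Arguments e R {n} j.
Arguments posroots R n : clear implicits.
Arguments WD R n : clear implicits.
Arguments cI R {n} I.
Arguments AI R {n} I.
Arguments BI R {n} I.

(* Main.v *)
Require Import Defs.
From mathcomp Require Import all_boot all_order all_algebra all_fingroup.
From mathcomp Require Import boolp classical_sets reals.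

(** The images under c = c_I of the positive roots are, for i < j < r,
      c(e_i - e_j) = e_(p j) - e_(p i),     c(e_i + e_j) = - e_(p i) - e_(p j),
      c(e_i - e_r) = - e_(p i) - e_(i_1),   c(e_i + e_r) = e_(i_1) - e_(p i).
    A linear form that is positive on all the positive roots ([height]) shows
    that e_x - e_y can be positive only for x < y and that - e_x - e_y never
    is.  Hence two families of images survive.

    The second one is e_(i_1) - e_(p i) with i_1 < p i.  As p is a permutation
    that sends r to i_1, p i takes each value q > i_1 exactly once for i < r,
    and this family is B_I.

    The first one is e_(p j) - e_(p i) with i < j < r and p j < p i, an
    inversion of p below r.  Below r the permutation p never decreases an
    index, so i < j <= p j < p i; thus i is moved, that is, i is in I and
    p i = n_I(i).  Then j lies strictly between two consecutive elements of
    I u {r}, so it is fixed by p and the image is e_j - e_(n_I(i)), in A_I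
    ([pI_inversion]).

    The sets are disjoint since the positive term e_b of an element of A_I has
    b > a >= i_1 for some a in I.  The formulas for the inverse are the two
    computations above read backwards, c being injective. *)

Set Implicit Arguments.
Unset Strict Implicit.
Unset Printing Implicit Defensive.

Import GRing.Theory Num.Theory.
Local Open Scope ring_scope.

Section Indices.
Variable n : nat.
Implicit Types (I : {set 'I_n.+1}) (a b i j q : 'I_n.+1).

Lemma ltn_ord_max j : (j < (ord_max : 'I_n.+1))%N = (j != ord_max).
Proof. by rewrite ltn_neqAle -ltnS ltn_ord andbT. Qed.

Lemma notin_neq_max I a : ord_max \notin I -> a \in I -> a != ord_max.
Proof. by move=> rI; apply: contraTneq => ->. Qed.

Lemma pI_nI I a : ord_max \notin I -> a \in I -> pI I a = nI I a.
Proof.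
move=> rI; rewrite -mem_enum => aI; rewrite -(nth_index ord_max aI).
by rewrite pI_nth ?nI_nth // cardE index_mem.
Qed.

(** For a < r the minimum is over a nonempty set, since r belongs to it. *)
Lemma nI_spec I a : a != ord_max ->
  (a < nI I a)%N /\ forall b, b \in ord_max |: I -> (a < b)%N -> (nI I a <= b)%N.
Proof.
move=> ar; rewrite /nI; case: arg_minnP; first by rewrite setU11 ltn_ord_max.
by move=> c /andP[_ ac] cmin; split=> // b bI ab; apply: cmin; rewrite bI.
Qed.

Lemma i1_le I a : a \in I -> (i1 I <= a)%N.
Proof.
rewrite -mem_enum /i1; have := enum_ord_sorted I.
case: (enum I) => [|x s] //= sxs; rewrite inE => /orP[/eqP -> //|a_s].
have /allP/(_ (val a)) := order_path_min ltn_trans sxs.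
by move=> h; apply/ltnW/h/map_f.
Qed.

Lemma leq_pI I j : ord_max \notin I -> j != ord_max -> (j <= pI I j)%N.
Proof.
move=> rI jr; have [jI|jI] := boolP (j \in I); last by rewrite pI_out.
by rewrite pI_nI //; apply: ltnW; case: (nI_spec I jr).
Qed.

Lemma pI_between I a b : a != ord_max -> (a < b)%N -> (b < nI I a)%N ->
  b != ord_max /\ pI I b = b.
Proof.
move=> ar ab bn; have br : b != ord_max.
  by rewrite -ltn_ord_max (leq_trans bn) // -ltnS ltn_ord.
split=> //; apply: pI_out => //; apply: contraTN bn => bI.
by rewrite -leqNgt; apply: (nI_spec I ar).2 => //; rewrite setU1r.
Qed.

(** Since i < j <= p j < p i, the index i is moved by p, and j is below the
    element p i that follows i in I u {r}. *)
Lemma pI_inversion I i j : ord_max \notin I -> j != ord_max ->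
  (i < j)%N -> (pI I j < pI I i)%N ->
  [/\ i \in I, (j < nI I i)%N, pI I j = j & pI I i = nI I i].
Proof.
move=> rI jr ij pji; have jp := leq_pI rI jr.
have ir : i != ord_max.
  by rewrite -ltn_ord_max (ltn_trans ij) // ltn_ord_max.
have iI : i \in I.
  apply: contraLR pji => iI.
  by rewrite -leqNgt (pI_out iI ir) (leq_trans (ltnW ij)).
have pE := pI_nI rI iI.
have jn : (j < nI I i)%N by rewrite -pE (leq_ltn_trans jp).
by split=> //; case: (pI_between ir ij jn).
Qed.

Lemma pI_preim I q : ord_max \notin I -> (i1 I < q)%N ->
  exists2 t, t != ord_max & pI I t = q.
Proof.
move=> rI iq; exists ((pI I)^-1%g q); last by rewrite permKV.
apply: contraTneq iq => tr; have := permKV (pI I) q.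
by rewrite tr pI_last // => ->; rewrite ltnn.
Qed.

End Indices.

Local Open Scope classical_set_scope.

Section Roots.
Variables (R : realType) (n : nat).
Implicit Types (i j x y : 'I_n.+1) (v w : 'rV[R]_n.+1).

(** Pairing with the dual vector (r - 1, ..., 1, 0), whose coordinates decrease
    strictly to 0: a witness for the positive system. *)
Definition height v : R := (v *m \col_i (n - i)%:R) ord0 ord0.

Lemma heightD v w : height (v + w) = height v + height w.
Proof. by rewrite /height mulmxDl mxE. Qed.

Lemma heightN v : height (- v) = - height v.
Proof. by rewrite /height mulNmx mxE. Qed.

Lemma height_e j : height (e R j) = (n - j)%:R.
Proof. by rewrite /height /e -rowE !mxE. Qed.

Lemma height_sub_gt0 x y : (0 < height (e R x - e R y)) = (x < y)%N.
Proof.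
rewrite heightD heightN !height_e subr_gt0 ltr_nat ltn_sub2lE //.
by rewrite -ltnS.
Qed.

Lemma height_posroot v : posroots R n v -> 0 < height v.
Proof.
move=> [i [j [ij [->|->]]]]; first by rewrite height_sub_gt0.
rewrite heightD !height_e -natrD ltr0n addn_gt0 subn_gt0.
by rewrite (leq_trans ij) // -ltnS.
Qed.

Lemma posroot_sub x y : posroots R n (e R x - e R y) <-> (x < y)%N.
Proof.
split=> [/height_posroot|xy]; first by rewrite height_sub_gt0.
by exists x, y; split=> //; left.
Qed.

Lemma posroot_oppD x y : ~ posroots R n (- e R x - e R y).
Proof.
move=> /height_posroot; rewrite heightD !heightN !height_e -opprD oppr_gt0.
by rewrite -natrD ltrn0.
Qed.

Lemma sub_e_injl b c x y : b != c -> e R b - e R c = e R x - e R y -> b = x.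
Proof.
move=> bc /rowP/(_ b); rewrite !mxE !eqxx (negbTE bc) subr0 /=.
case: eqP => //= _ /eqP; rewrite sub0r => h.
have : (0 : R) < - (b == y)%:R by rewrite -(eqP h) ltr01.
by rewrite oppr_gt0 ltrn0.
Qed.

End Roots.

Section Image.
Variables (R : realType) (n : nat) (I : {set 'I_n.+1}).
Hypothesis rI : ord_max \notin I.
Implicit Types (a b i j t : 'I_n.+1).

Lemma cI_sub i j : i != ord_max -> j != ord_max ->
  cI R I (e R i - e R j) = e R (pI I j) - e R (pI I i).
Proof.
move=> ir jr; rewrite linearB /= !cI_e (negbTE ir) (negbTE jr).
by rewrite opprK addrC.
Qed.

Lemma cI_addmax t : t != ord_max ->
  cI R I (e R t + e R ord_max) = e R (i1 I) - e R (pI I t).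
Proof. by move=> tr; rewrite linearD /= !cI_e (negbTE tr) eqxx addrC. Qed.

Lemma cI_gap a b : a \in I -> (a < b)%N -> (b < nI I a)%N ->
  cI R I (e R a - e R b) = e R b - e R (nI I a).
Proof.
move=> aI ab bn; have ar := notin_neq_max rI aI.
by have [br pb] := pI_between ar ab bn; rewrite cI_sub // pb pI_nI.
Qed.

(** The surviving images; those of e_i + e_j with j < r and of e_i - e_r are
    sums of two opposites of basis vectors. *)
Lemma cI_posroots_sub v : posroots R n v -> posroots R n (cI R I v) ->
  (AI R I `|` BI R I) (cI R I v).
Proof.
move=> [i [j [ij vE]]]; have ir : i != ord_max.
  by rewrite -ltn_ord_max (leq_trans ij) // -ltnS ltn_ord.
have [jr|jr] := eqVneq j ord_max; case: vE => ->.
- rewrite linearB /= !cI_e (negbTE ir) jr eqxx.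
  by move=> /posroot_oppD.
- by rewrite jr cI_addmax // => /posroot_sub iq; right; exists (pI I i).
- rewrite cI_sub // => /posroot_sub pji; left.
  have [iI jn pj pi] := pI_inversion rI jr ij pji.
  by exists i, j; rewrite pj pi.
- rewrite linearD /= !cI_e (negbTE ir) (negbTE jr).
  by move=> /posroot_oppD.
Qed.

Lemma nu0_cI : nu0 (cI R I) = AI R I `|` BI R I.
Proof.
apply/seteqP; split=> [_ [[v vpos <-]]|w]; first exact: cI_posroots_sub.
case=> [[a [b [aI ab bn ->]]]|[q [iq ->]]]; split; try exact/posroot_sub.
  by exists (e R a - e R b); [apply/posroot_sub | apply: cI_gap].
have [t tr <-] := pI_preim rI iq.
exists (e R t + e R ord_max); last exact: cI_addmax.
by exists t, ord_max; split; [rewrite ltn_ord_max | right].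
Qed.

(** The positive terms differ: the one of an element of A_I has an index larger
    than some a in I, hence larger than i_1. *)
Lemma AI_BI_disjoint : AI R I `&` BI R I = set0.
Proof.
apply/seteqP; split=> // _ [[a [b [aI ab bn ->]]] [q [_ bqE]]].
have bE : b = i1 I by apply: sub_e_injl bqE; rewrite neq_ltn bn.
by move: ab; rewrite bE ltnNge i1_le.
Qed.

(** c_I has r - 1 negative signs, so it is in W(D_r) exactly when r is odd. *)
Lemma cI_lfunK v : odd n.+1 -> (cI R I)^-1%VF (cI R I v) = v.
Proof. by move=> r_odd; apply/lker0_lfunK/WD_lker0/cI_WD. Qed.

End Image.

Theorem proposition3p1 (R : realType) (n : nat) (I : {set 'I_n.+1})
    (r_ge5 : (5 <= n.+1)%N) (r_odd : odd n.+1)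
    (I_neq0 : I != finset.set0) (rI : ord_max \notin I) :
  [/\ nu0 (cI R I) = AI R I `|` BI R I,
      AI R I `&` BI R I = set0,
      forall a b : 'I_n.+1, a \in I -> (a < b)%N -> (b < nI I a)%N ->
        (cI R I)^-1%VF (e R b - e R (nI I a)) = e R a - e R b
    & forall q : 'I_n.+1, (i1 I < q)%N ->
        exists2 t : 'I_n.+1,
          unique (fun j => j != ord_max /\ pI I j = q) t
        & (cI R I)^-1%VF (e R (i1 I) - e R q) = e R t + e R ord_max].
Proof.
split; [exact: nu0_cI | exact: AI_BI_disjoint | |].
  by move=> a b aI ab bn; rewrite -(cI_gap R rI aI ab bn) cI_lfunK.
move=> q /(pI_preim rI)[t tr <-]; exists t; last first.
  by rewrite -cI_addmax // cI_lfunK.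
by split=> // t' [_ /perm_inj].
Qed.
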